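(* There exists an absolute constant $C>0$ such that for all integers $2\le k\le n$ and all $0<\rho_n\le 1$, in the network sequence model, $$\inf_{\widehat{\boldsymbol T}}\ \sup_{\boldsymbol\Theta_0\in\mathcal T[k,\rho_n]}\mathbb E_{\boldsymbol\Theta_0}\left[\frac{1}{n^2}\|\widehat{\boldsymbol T}-\boldsymbol\Theta_0\|_F^2\right]\ \ge\ C\min\left(\rho_n\left(\frac{\log k}{n}+\frac{k^2}{n^2}\right),\ \rho_n^2\right),$$ where the infimum is over all estimators $\widehat{\boldsymbol T}$ of $\boldsymbol\Theta_0$.
   Context: Network sequence model: given a symmetric $n\times n$ matrix $\boldsymbol\Theta_0$ with entries in $[0,1]$ and zero diagonal, one observes $\boldsymbol A'=(\boldsymbol A_{ij},\,1\le j<i\le n)$, independent Bernoulli variables with $\mathbb P(\boldsymbol A_{ij}=1)=(\boldsymbol\Theta_0)_{ij}$; $\mathbb E_{\boldsymbol\Theta_0}$ is the corresponding expectation. An estimator $\widehat{\boldsymbol T}$ is any ($n\times n$-matrix-valued, measurable) function of $\boldsymbol A'$. $\|\cdot\|_F$ is the Frobenius norm and $\|\cdot\|_\infty$ the entrywise supremum norm. $\mathcal Z_{n,k}$ is the set of surjective maps $z:\{1,\dots,n\}\to\{1,\dots,k\}$. $\mathcal T[k]$ is the set of probability matrices $\boldsymbol\Theta$ (entries in $[0,1]$) for which there exist $z\in\mathcal Z_{n,k}$ and a symmetric $k\times k$ real matrix $\boldsymbol Q$ with $\boldsymbol\Theta_{ij}=\boldsymbol Q_{z(i)z(j)}$ for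 $i\ne j$ and $\boldsymbol\Theta_{ii}=0$. $\mathcal T[k,\rho_n]=\{\boldsymbol\Theta_0\in\mathcal T[k]:\ \|\boldsymbol\Theta_0\|_\infty\le\rho_n\}$. *)

(* Defs.v *)
From HB Require Import structures.
From mathcomp Require Import all_boot all_order all_algebra.
From mathcomp Require Import all_classical all_reals all_analysis.

Set Implicit Arguments.
Unset Strict Implicit.
Unset Printing Implicit Defensive.

Import Order.TTheory GRing.Theory Num.Theory.

Local Open Scope classical_set_scope.
Local Open Scope ring_scope.

(* The index set {(i, j) | 1 <= j < i <= n} of the observed entries. *)
Definition edge (n : nat) := {p : 'I_n * 'I_n | (p.2 < p.1)%N}.

(* The values of the observation A' = (A_ij, j < i). This is a finite set with
   its discrete sigma-algebra, so every function on it is measurable. *)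
Definition observation (n : nat) := {ffun edge n -> bool}.

Definition estimator (R : realType) (n : nat) := observation n -> 'M[R]_n.

Definition frobenius_norm (R : realType) (m n : nat) (M : 'M[R]_(m, n)) : R :=
  Num.sqrt (\sum_(i < m) \sum_(j < n) M i j ^+ 2).

Definition probability_matrix (R : realType) (n : nat) (Theta : 'M[R]_n) :=
  forall i j, 0 <= Theta i j <= 1.

Definition model_parameter (R : realType) (n : nat) : set 'M[R]_n :=
  [set Theta | [/\ probability_matrix Theta,
                   Theta^T = Theta
                 & forall i, Theta i i = 0]].

Definition mutually_independent (d d' : measure_display) (R : realType)
    (Omega : measurableType d) (T : measurableType d') (P : probability Omega R)
    (I : finType) (X : I -> {RV P >-> T}) :=
  forall (J : {set I}) (B : I -> set T),
    (forall i, i \in J -> measurable (B i)) ->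
    P (\bigcap_(i in [set` J]) (X i @^-1` B i)) =
    (\prod_(i in J) P (X i @^-1` B i))%E.

Definition network_sequence_model (d : measure_display) (R : realType)
    (n : nat) (Omega : measurableType d) (P : probability Omega R)
    (A : edge n -> {mfun Omega >-> bool}) (Theta : 'M[R]_n) :=
  mutually_independent (P := P) A /\
  forall e : edge n,
    P (A e @^-1` [set true]) = (Theta (val e).1 (val e).2)%:E.

Definition observed (d : measure_display) (n : nat) (Omega : measurableType d)
    (A : edge n -> {mfun Omega >-> bool}) (w : Omega) : observation n :=
  [ffun e => A e w].

(* A probability space (Omega, P Theta) for each parameter Theta, with the
   observed variables A_ij common to all of them: E_Theta is the expectation
   under P Theta. The family P is only constrained on valid parameters. *)
Definition network_experiment (d : measure_display) (R : realType) (n : nat)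
    (Omega : measurableType d) (P : 'M[R]_n -> probability Omega R)
    (A : edge n -> {mfun Omega >-> bool}) :=
  forall Theta, model_parameter Theta ->
    network_sequence_model (P Theta) A Theta.

Definition block_matrices (R : realType) (n k : nat) : set 'M[R]_n :=
  [set Theta | probability_matrix Theta /\
    exists (z : 'I_n -> 'I_k) (Q : 'M[R]_k),
      [/\ set_surj [set: 'I_n] [set: 'I_k] z,
          Q^T = Q,
          (forall i j, i != j -> Theta i j = Q (z i) (z j))
        & forall i, Theta i i = 0]].

(* [mx_norm] is the entrywise supremum norm. *)
Definition sparse_block_matrices (R : realType) (n k : nat) (rho : R) :
    set 'M[R]_n :=
  [set Theta | block_matrices k Theta /\ mx_norm Theta <= rho].

Definition risk (d : measure_display) (R : realType) (n : nat)
    (Omega : measurableType d) (P : 'M[R]_n -> probability Omega R)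
    (A : edge n -> {mfun Omega >-> bool}) (That : estimator R n)
    (Theta : 'M[R]_n) : \bar R :=
  'E_(P Theta)[fun w =>
    ((n%:R ^+ 2)^-1 * frobenius_norm (That (observed A w) - Theta) ^+ 2)%R]%E.

Definition minimax_risk (d : measure_display) (R : realType) (n : nat)
    (Omega : measurableType d) (P : 'M[R]_n -> probability Omega R)
    (A : edge n -> {mfun Omega >-> bool}) (S : set 'M[R]_n) : \bar R :=
  ereal_inf [set ereal_sup [set risk P A That Theta | Theta in S]
            | That in [set: estimator R n]].

(* Main.v *)
Require Import Defs.
From mathcomp Require Import all_boot all_order all_algebra.
From mathcomp Require Import all_classical all_reals all_analysis.
From mathcomp Require Import measurable_realfun ring lra zify.

Import Order.TTheory GRing.Theory Num.Theory.

(** The lower bound comes from replacing the supremum over parameters by the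
    average over finitely many of them. A configuration is a function om from
    a finite set I of coordinates to a finite alphabet V; the coordinates are
    to be thought of as independent and uniform. Each configuration gives a
    matrix theta om whose off-diagonal entries are rho/2 + delta or
    rho/2 - delta.

    Only one coordinate i is guessed at a time, the others being revealed. The
    #|V| competing laws then differ only on a set of at most N edges, and their
    chi-square divergence to the law with success probability rho/2 on these
    edges is at most (1 + 4 delta^2 / rho)^N - 1. If N delta^2 / rho is at most
    ln #|V| / 8, this is less than 3/4 #|V|, so that no test recovers om i with
    probability above 7/8 ([testing_error]), whether V has two elements or
    many. An estimator with small quadratic loss on the entries
    that om i governs would be such a test ([quadratic_testing]). Since
    different coordinates govern disjoint sets of entries, the losses add up
    over the coordinates ([product_prior_risk]). The same argument thus serves
    as the lemma of Assouad for binary coordinates, and as that of Fano for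
    large alphabets.

    Two priors give the two terms of the rate.

    - The connection probabilities are unknown and the communities known
      ([minimax_risk_blocks]): a coordinate is the sign of a block, with two
      letters and N of order (n/k)^2, whence the term k^2 / n^2.

    - The connection probabilities are known and the communities unknown
      ([minimax_risk_labels]): a coordinate is the community of a node, with
      an alphabet of 2^r letters where 2^r <= k < 2^(r+1), and N of order n,
      whence the term ln k / n. The signs of the blocks are those of a Walsh
      matrix, in which two different rows disagree in half of the columns. Half
      of the nodes have known labels; this makes the rows of two candidate
      labels far apart, whatever the labels of the other nodes. The known nodes
      have to meet all k communities, which is possible if 2k <= n; otherwise
      ln k / n <= 2 k^2 / n^2 and the first prior suffices. *)

Set Implicit Arguments.
Unset Strict Implicit.
Unset Printing Implicit Defensive.

Local Open Scope ring_scope.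

(** * Testing and estimating one coordinate *)

(** The probabilities of success add up to the sum over x of P (psi x) x. With
    L v x the ratio P v x / q x, the square of L (psi x) x is at most the sum
    over v of the squares of the L v x, whose q-mean is at most
    #|V| * (3/4 #|V|). So the success is at most sqrt (3/4) #|V|, by
    Cauchy-Schwarz, and 7/8 exceeds sqrt (3/4). *)
Lemma testing_error (R : realFieldType) (X V : finType) (P : V -> X -> R)
    (q : X -> R) (psi : X -> V) :
    (0 < #|V|)%N ->
    (forall x, 0 < q x) -> \sum_x q x = 1 ->
    (forall v, \sum_x P v x = 1) ->
    (forall v, \sum_x P v x ^+ 2 / q x <= 3 / 4 * #|V|%:R) ->
  #|V|%:R / 8 <= \sum_v \sum_x P v x * (psi x != v)%:R.
Proof.
move=> V0 q0 q1 P1 chi; set M : R := #|V|%:R.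
have M0 : 0 < M by rewrite ltr0n.
have success : \sum_x P (psi x) x <= 7 / 8 * M.
  (* Cauchy-Schwarz in linearized form: 2 L <= L^2 / c + c, with
     c = 7/8 * M close to the optimal value sqrt (3/4) * M. *)
  have amgm x : P (psi x) x <=
      4 / (7 * M) * (\sum_v P v x ^+ 2 / q x) + 7 / 16 * M * q x.
    have le1 : P (psi x) x ^+ 2 / q x <= \sum_v P v x ^+ 2 / q x.
      rewrite (bigD1 (psi x)) //= lerDl sumr_ge0 // => v _.
      by rewrite divr_ge0 ?sqr_ge0 // ltW.
    apply: le_trans (lerD (ler_wpM2l _ le1) (lexx _)); last first.
      by rewrite divr_ge0 // mulr_ge0 // ltW.
    set a := P _ _; have q0x := q0 x; set b := q x in q0x *.
    rewrite -subr_ge0.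
    have -> : 4 / (7 * M) * (a ^+ 2 / b) + 7 / 16 * M * b - a =
        (a - 7 / 8 * M * b) ^+ 2 * (4 / (7 * M * b)).
      by field; lra.
    rewrite mulr_ge0 ?sqr_ge0 // divr_ge0 // mulr_ge0 ?(ltW q0x) //.
    by rewrite mulr_ge0 // ltW.
  apply: le_trans (ler_sum _ (fun x _ => amgm x)) _.
  rewrite big_split /= -!mulr_sumr q1 mulr1 exchange_big /=.
  have chis : \sum_v \sum_x P v x ^+ 2 / q x <= 3 / 4 * M * M.
    apply: le_trans (ler_sum _ (fun v _ => chi v)) _.
    by rewrite sumr_const -[leLHS]mulr_natr.
  apply: (@le_trans _ _ (4 / (7 * M) * (3 / 4 * M * M) + 7 / 16 * M)).
    by rewrite lerD2r ler_wpM2l // divr_ge0 // mulr_ge0 // ltW.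
  have -> : 4 / (7 * M) * (3 / 4 * M * M) = 3 / 7 * M by field; lra.
  lra.
have total : \sum_v \sum_x P v x * (psi x != v)%:R + \sum_x P (psi x) x = M.
  rewrite exchange_big -big_split /=.
  rewrite (eq_bigr (fun x => \sum_v P v x)); last first.
    move=> x _; rewrite [RHS](bigD1 (psi x)) //= addrC; congr (_ + _).
    rewrite (bigD1 (psi x)) //= eqxx mulr0 add0r.
    by apply: eq_bigr => v; rewrite eq_sym => ->; rewrite mulr1.
  rewrite exchange_big /=.
  under eq_bigr do rewrite P1.
  by rewrite sumr_const -[X in _ *+ X]/#|V|.
lra.
Qed.

(** An estimator T yields a test by choosing the closest hypothesis. When the
    test errs, T is at squared distance at least s / 4 from the true
    hypothesis, because it is no farther from another one. *)
Lemma quadratic_testing (R : realFieldType) (X V D : finType) (P : V -> X -> R)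
    (q : X -> R)
    (B : pred D) (T : X -> D -> R) (th : V -> D -> R) (s : R) :
    (0 < #|V|)%N ->
    (forall x, 0 < q x) -> \sum_x q x = 1 ->
    (forall v x, 0 <= P v x) ->
    (forall v, \sum_x P v x = 1) ->
    (forall v, \sum_x P v x ^+ 2 / q x <= 3 / 4 * #|V|%:R) ->
    0 <= s ->
    (forall u v, u != v -> s <= \sum_(d | B d) (th u d - th v d) ^+ 2) ->
  #|V|%:R * (s / 32) <=
    \sum_v \sum_x P v x * \sum_(d | B d) (T x d - th v d) ^+ 2.
Proof.
move=> V0 q0 q1 P0 P1 chi s0 sep.
have /card_gt0P[v0 _] := V0.
pose dist x v := \sum_(d | B d) (T x d - th v d) ^+ 2.
pose psi x := [arg min_(v < v0) dist x v]%O.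
have err := testing_error psi V0 q0 q1 P1 chi.
have loss x v : s / 4 * (psi x != v)%:R <= dist x v.
  have [|ne] := eqVneq; rewrite ?mulr0 ?mulr1.
    by move=> _; apply: sumr_ge0 => d _; exact: sqr_ge0.
  have psi_min : dist x (psi x) <= dist x v.
    by rewrite /psi; case: arg_minP => // w _; apply.
  suff : s <= 2 * dist x (psi x) + 2 * dist x v by lra.
  apply: le_trans (sep _ _ ne) _.
  rewrite !mulr_sumr -big_split /=; apply: ler_sum => d _.
  rewrite -subr_ge0.
  set a := T x d; set b := th _ d; set c := th v d.
  have -> : 2 * (a - b) ^+ 2 + 2 * (a - c) ^+ 2 - (b - c) ^+ 2 =
    (2 * a - b - c) ^+ 2 by ring.
  exact: sqr_ge0.
have -> : #|V|%:R * (s / 32) = s / 4 * (#|V|%:R / 8) by field.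
apply: le_trans (ler_wpM2l _ err) _; first by rewrite divr_ge0.
rewrite mulr_sumr; apply: ler_sum => v _; rewrite mulr_sumr.
by apply: ler_sum => x _; rewrite mulrCA ler_wpM2l // loss.
Qed.

Definition update (I : finType) (V : Type) (om : {ffun I -> V}) i v :=
  [ffun j => if j == i then v else om j].

(** Exchanging v and om i is an involution of the pairs (om, v): resampling a
    coordinate preserves the uniform distribution. This reduces an average over
    configurations to averages over a single coordinate. *)
Lemma sum_update (R : realFieldType) (I V : finType) (i : I)
    (g : {ffun I -> V} -> R) :
  \sum_om \sum_v g (update om i v) = #|V|%:R * \sum_om g om.
Proof.
rewrite pair_big /=.
pose swap (p : {ffun I -> V} * V) := (update p.1 i p.2, p.1 i).
have swapK : involutive swap.
  move=> [om v]; congr pair => /=; last by rewrite ffunE eqxx.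
  by apply/ffunP => j; rewrite !ffunE; case: eqVneq => // ->.
rewrite (reindex_inj (inv_inj swapK)) /=.
rewrite (eq_bigr (fun p : {ffun I -> V} * V => g p.1)); last first.
  move=> p _; congr g; apply/ffunP => j; rewrite !ffunE.
  by case: eqVneq => // ->.
rewrite -(pair_big xpredT xpredT (fun om _ => g om)) /= mulr_sumr.
by apply: eq_bigr => om _; rewrite sumr_const -[X in _ *+ X]/#|V| mulr_natl.
Qed.

(** * The law of the observation *)

Definition bernoulli_mass (R : realType) (t : R) (b : bool) : R :=
  if b then t else 1 - t.

Definition product_law (R : realType) (I : finType) (t : I -> R)
    (x : {ffun I -> bool}) : R :=
  \prod_i bernoulli_mass (t i) (x i).

Definition edge_prob (R : realType) (n : nat) (Theta : 'M[R]_n) (e : edge n) :=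
  Theta (val e).1 (val e).2.

Lemma observed_law d (R : realType) n (Omega : measurableType d)
    (P : probability Omega R) (A : edge n -> {mfun Omega >-> bool})
    (Theta : 'M[R]_n) (x : observation n) :
    network_sequence_model P A Theta ->
  d.-measurable%classic [set w | observed A w = x]%classic /\
  P [set w | observed A w = x]%classic = (product_law (edge_prob Theta) x)%:E.
Proof.
move=> [indep marg].
have -> : [set w | observed A w = x]%classic =
    (\bigcap_(e in [set` [set: edge n]%SET]) (A e @^-1` [set x e]))%classic.
  apply/seteqP; split => w /=.
    by move=> <- e _; rewrite /= ffunE.
  move=> h; apply/ffunP => e; rewrite ffunE; apply: h.
  by rewrite /= finset.in_setT.
split.
  apply: fin_bigcap_measurable; first exact: finite_finset.
  by move=> e _; rewrite -[X in measurable X]setTI; exact: measurable_funPT.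
rewrite indep // /product_law -prodEFin; apply: congr_big => //.
  by move=> e; rewrite finset.in_setT.
move=> e _; rewrite /bernoulli_mass.
case: (x e); first exact: marg.
have -> : (A e @^-1` [set false] = ~` (A e @^-1` [set true]))%classic.
  by apply/seteqP; split => w /=; case: (A e w).
rewrite probability_setC ?marg //.
by rewrite -[X in measurable X]setTI; exact: measurable_funPT.
Qed.

Lemma expectation_observed d (R : realType) n (Omega : measurableType d)
    (P : probability Omega R) (A : edge n -> {mfun Omega >-> bool})
    (Theta : 'M[R]_n) (f : observation n -> R) :
    network_sequence_model P A Theta -> (forall x, 0 <= f x) ->
  'E_P[fun w => f (observed A w)]%E =
    (\sum_x product_law (edge_prob Theta) x * f x)%:E.
Proof.
move=> model f0; rewrite unlock.
pose F (x : observation n) := [set w | observed A w = x]%classic.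
have mF x : d.-measurable%classic (F x) by case: (observed_law x model).
rewrite (eq_integral (fun w =>
    (\sum_(x : observation n) (f x * \1_(F x) w)%:E)%E)); last first.
  move=> w _; rewrite (bigD1 (observed A w)) //= indicE mem_set //= mulr1.
  rewrite big1 ?adde0 // => x; rewrite eq_sym => /eqP ne.
  by rewrite indicE memNset ?mulr0.
rewrite ge0_integral_sum //; first last.
- by move=> x w _; rewrite lee_fin mulr_ge0 ?f0.
- move=> x; apply/measurable_EFinP; apply: measurable_funM => //.
rewrite -sumEFin; apply: eq_bigr => x _.
rewrite (eq_integral (fun w => (f x)%:E * (\1_(F x) w)%:E)%E); last by [].
rewrite ge0_integralZl ?lee_fin //; last exact/measurable_EFinP.
rewrite integral_indic // setIT /F.
by case: (observed_law x model) => _ lawx; rewrite EFinM -lawx muleC.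
Qed.

(** * Risk under a product prior *)

Lemma product_law_gt0 (R : realType) (I : finType) (t : I -> R) x :
  (forall i, 0 < t i < 1) -> 0 < product_law t x.
Proof.
move=> t01; apply: prodr_gt0 => i _; have := t01 i.
by rewrite /bernoulli_mass; case: (x i) => ?; lra.
Qed.

Lemma sum_product_law (R : realType) (I : finType) (t : I -> R) :
  \sum_x product_law t x = 1.
Proof.
rewrite -(bigA_distr_bigA (fun i b => bernoulli_mass (t i) b)).
by apply: big1 => i _; rewrite big_bool /=; ring.
Qed.

(** The sum of P^2 / q factorizes over the coordinates. A coordinate with
    success probabilities t and t0 contributes
    1 + (t - t0)^2 / (t0 (1 - t0)), which is 1 where the two laws agree. *)
Lemma product_law_chi2 (R : realType) (I : finType) (E : {set I})
    (t t0 : I -> R) (p delta : R) :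
    0 < p < 1 -> (forall i, 0 < t0 i < 1) ->
    {in E, forall i, t0 i = p /\ `|t i - p| <= delta} ->
    (forall i, i \notin E -> t i = t0 i) ->
  \sum_x product_law t x ^+ 2 / product_law t0 x <=
    (1 + delta ^+ 2 / (p * (1 - p))) ^+ #|E|.
Proof.
move=> p01 t01 near_p off_E.
pose chi i (b : bool) :=
  bernoulli_mass (t i) b ^+ 2 / bernoulli_mass (t0 i) b.
have -> : \sum_x product_law t x ^+ 2 / product_law t0 x =
    \prod_i \sum_b chi i b.
  rewrite bigA_distr_bigA; apply: eq_bigr => x _.
  by rewrite /product_law -prodrXl -prodf_div.
have chiE i : \sum_b chi i b = 1 + (t i - t0 i) ^+ 2 / (t0 i * (1 - t0 i)).
  rewrite big_bool /chi /=; have := t01 i => ?.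
  by field; apply/andP; split; lra.
rewrite (bigID (mem E)) /= [X in _ * X]big1 ?mulr1; last first.
  by move=> i iE; rewrite chiE off_E // subrr expr0n mul0r addr0.
rewrite -prodr_const; apply: ler_prod => i iE.
have [t0p near_i] := near_p i iE.
rewrite chiE t0p.
have pp : 0 <= (p * (1 - p))^-1 by rewrite invr_ge0 mulr_ge0 //; lra.
apply/andP; split; first by rewrite addr_ge0 // mulr_ge0 // sqr_ge0.
rewrite lerD2l ler_wpM2r // -real_normK ?num_real //.
by rewrite lerXn2r // nnegrE ?normr_ge0 // (le_trans (normr_ge0 _) near_i).
Qed.

(** The left-hand side is at most exp (N c) <= sqrt M, and sqrt M <= 3/4 M as
    soon as M >= 16/9: an alphabet of two letters is large enough. *)
Lemma pow_le_three_quarters (R : realType) (c : R) (N M : nat) :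
    (1 < M)%N -> 0 <= c -> N%:R * c <= ln M%:R / 2 ->
  (1 + c) ^+ N <= 3 / 4 * M%:R.
Proof.
move=> M1 c0 cN.
have M0 : (0 : R) < M%:R by rewrite ltr0n ltnW.
have M2 : (2 : R) <= M%:R by rewrite ler_nat.
pose y : R := expR (ln M%:R / 2).
have y2 : y ^+ 2 = M%:R.
  by rewrite /y -expRM_natl mulrC divfK // lnK.
have y0 : 0 < y by exact: expR_gt0.
apply: (@le_trans _ _ y).
  apply: (@le_trans _ _ (expR c ^+ N)).
    by rewrite lerXn2r ?nnegrE ?expR_ge0 ?expR_ge1Dx // addr_ge0.
  by rewrite -expRM_natl ler_expR.
rewrite -y2; rewrite -y2 in M2.
have : 4 / 3 <= y by nra.
by nra.
Qed.

(** [key] attributes each entry of the matrix to the only coordinate that is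
    charged for the loss there, so that the losses of the coordinates can be
    added; [E i] contains the edges whose law may depend on coordinate i, and
    hence carries the information on it. The coordinates outside J are
    dummies. *)
Lemma product_prior_risk (R : realType) (n : nat) (I V : finType)
    (theta : {ffun I -> V} -> 'M[R]_n) (J : {set I}) (key : 'I_n * 'I_n -> I)
    (E : I -> {set edge n}) (p delta s : R) (N : nat)
    (T : observation n -> 'M[R]_n) :
    (1 < #|V|)%N -> 0 < p < 1 ->
    (forall om e, 0 < edge_prob (theta om) e < 1) ->
    (forall om e, `|edge_prob (theta om) e - p| <= delta) ->
    (forall om i v e, i \in J -> e \notin E i ->
       edge_prob (theta (update om i v)) e = edge_prob (theta om) e) ->
    (forall i, i \in J -> (#|E i| <= N)%N) ->
    N%:R * (delta ^+ 2 / (p * (1 - p))) <= ln #|V|%:R / 2 ->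
    0 <= s ->
    (forall om i u v, i \in J -> u != v ->
       s <= \sum_(d | key d == i)
         (theta (update om i u) d.1 d.2 -
            theta (update om i v) d.1 d.2) ^+ 2) ->
  #|{ffun I -> V}|%:R * (#|J|%:R * (s / 32)) <=
    \sum_om \sum_x product_law (edge_prob (theta om)) x *
      \sum_d (T x d.1 d.2 - theta om d.1 d.2) ^+ 2.
Proof.
move=> V1 p01 theta01 near_p local cardE small s0 sep.
have M0 : (0 : R) < #|V|%:R by rewrite ltr0n ltnW.
pose loss i om := \sum_x product_law (edge_prob (theta om)) x *
  \sum_(d | key d == i) (T x d.1 d.2 - theta om d.1 d.2) ^+ 2.
have coord i : i \in J ->
    #|{ffun I -> V}|%:R * (s / 32) <= \sum_om loss i om.
  move=> iJ; rewrite -(ler_pM2l M0) -(sum_update i (loss i)).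
  rewrite mulrCA [leLHS]mulr_natl -sumr_const; apply: ler_sum => om _.

  (* The reference law keeps the true probabilities of the edges outside E i,
     which do not depend on the coordinate to be guessed. *)
  pose t0 e := if e \in E i then p else edge_prob (theta om) e.
  have t01 e : 0 < t0 e < 1 by rewrite /t0; case: ifP.
  apply: (@quadratic_testing _ _ _ _ _ (product_law t0)) => //.
  - exact: ltnW.
  - by move=> x; exact: product_law_gt0.
  - exact: sum_product_law.
  - by move=> v x; exact/ltW/product_law_gt0.
  - by move=> v; exact: sum_product_law.
  - move=> v.
    apply: le_trans (@product_law_chi2 _ _ (E i) _ _ p delta p01 t01 _ _) _.
    + by move=> e eE; rewrite /t0 eE.
    + by move=> e eE; rewrite /t0 (negbTE eE) local.
    have c0 : 0 <= delta ^+ 2 / (p * (1 - p)).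
      by rewrite divr_ge0 ?sqr_ge0 // mulr_ge0 //; lra.
    apply: pow_le_three_quarters => //.
    by apply: le_trans small; rewrite ler_wpM2r // ler_nat cardE.
  - by move=> u v uv; exact: sep.
apply: (@le_trans _ _ (\sum_(i in J) \sum_om loss i om)).
  rewrite mulrCA mulr_natl -sumr_const; exact: ler_sum.
rewrite exchange_big /=; apply: ler_sum => om _.
rewrite exchange_big /=; apply: ler_sum => x _.
rewrite -mulr_sumr ler_wpM2l ?(ltW (product_law_gt0 _ _)) //.
rewrite [leRHS](partition_big key xpredT) //= [leRHS](bigID (mem J)) /= lerDl.
by apply: sumr_ge0 => i _; apply: sumr_ge0 => d _; exact: sqr_ge0.
Qed.

(** * Block matrices with random signs *)

Lemma minimax_risk_ge (R : realType) (n : nat) (d : measure_display)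
    (Omega : measurableType d) (P : 'M[R]_n -> probability Omega R)
    (A : edge n -> {mfun Omega >-> bool}) (S : set 'M[R]_n) (W : finType)
    (theta : W -> 'M[R]_n) (L : R) :
    network_experiment P A -> (0 < #|W|)%N ->
    (forall om, S (theta om)) -> (forall om, model_parameter (theta om)) ->
    (forall T : observation n -> 'M[R]_n, #|W|%:R * L <=
      \sum_om \sum_x product_law (edge_prob (theta om)) x *
        \sum_p (T x p.1 p.2 - theta om p.1 p.2) ^+ 2) ->
  (((n%:R ^+ 2)^-1 * L)%:E <= minimax_risk P A S)%E.
Proof.
move=> expt W0 thetaS theta_model avg.
apply: le_ereal_inf_tmp => _ [T _ <-].
pose Rk om := \sum_x product_law (edge_prob (theta om)) x *
  \sum_p (T x p.1 p.2 - theta om p.1 p.2) ^+ 2.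
have riskE om : risk P A T (theta om) = ((n%:R ^+ 2)^-1 * Rk om)%:E.
  have loss_ge0 (x : observation n) :
      0 <= (n%:R ^+ 2)^-1 * frobenius_norm (T x - theta om) ^+ 2.
    by rewrite mulr_ge0 ?invr_ge0 ?sqr_ge0.
  rewrite /risk (expectation_observed (expt _ (theta_model om)) loss_ge0).
  congr EFin; rewrite mulr_sumr; apply: eq_bigr => x _.
  rewrite mulrCA; congr (_ * (_ * _)).
  rewrite sqr_sqrtr; last first.
    by apply: sumr_ge0 => i _; apply: sumr_ge0 => j _; exact: sqr_ge0.
  rewrite pair_big /=; apply: eq_bigr => p _.
  by rewrite !mxE.
have [om Lom] : exists om, L <= Rk om.
  apply: contrapT => /forallNP lt_L.
  have [om0 _] := card_gt0P W0.
  have : \sum_om Rk om < #|W|%:R * L.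
    rewrite mulr_natl -sumr_const; apply: ltr_sum.
      by apply/hasP; exists om0; rewrite ?mem_index_enum.
    by move=> om _; rewrite ltNge; apply/negP.
  by rewrite ltNge avg.
apply: le_ereal_sup_tmp; exists (risk P A T (theta om)).
  by exists (theta om).
by rewrite riskE lee_fin ler_wpM2l // invr_ge0 sqr_ge0.
Qed.

Definition block_matrix (R : realType) (n k : nat) (z : 'I_n -> 'I_k)
    (Q : 'M[R]_k) : 'M[R]_n :=
  \matrix_(i, j) if i == j then 0 else Q (z i) (z j).

Lemma block_matrix_model (R : realType) (n k : nat) (z : 'I_n -> 'I_k)
    (Q : 'M[R]_k) :
    (forall a b, 0 <= Q a b <= 1) -> Q^T = Q ->
  model_parameter (block_matrix z Q).
Proof.
move=> Q01 Qsym; split.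
- by move=> i j; rewrite mxE; case: eqP => // _; rewrite lexx ler01.
- apply/matrixP => i j; rewrite !mxE eq_sym; case: eqP => // _.
  by rewrite -[in RHS]Qsym mxE.
- by move=> i; rewrite mxE eqxx.
Qed.

Lemma block_matrix_sparse (R : realType) (n k : nat) (z : 'I_n -> 'I_k)
    (Q : 'M[R]_k) (rho : R) :
    0 <= rho <= 1 -> (forall a b, 0 <= Q a b <= rho) -> Q^T = Q ->
    (forall a, exists i, z i = a) ->
  sparse_block_matrices k rho (block_matrix z Q).
Proof.
move=> rho01 Qrho Qsym z_surj; split; first split.
- have [] // := @block_matrix_model _ _ _ z Q _ Qsym.
  by move=> a b; have := Qrho a b; lra.
- exists z, Q; split => //.
  + by move=> a _; have [i zi] := z_surj a; exists i.
  + by move=> i j ij; rewrite mxE (negbTE ij).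
  + by move=> i; rewrite mxE eqxx.
- rewrite mx_normrE; apply: bigmax_le; first by case/andP: rho01.
  move=> p _; rewrite mxE; case: eqP => [_|_]; first by rewrite normr0; lra.
  by have := Qrho (z p.1) (z p.2) => /andP[Q0 ?]; rewrite ger0_norm.
Qed.

(** The prior may act both on the labels of the nodes and on the signs of the
    blocks. The value of delta^2 is the minimum in the conclusion: its first
    term keeps the probabilities in [rho/4, 3 rho/4], its second makes the
    chi-square condition of [product_prior_risk] hold, since
    rho/2 (1 - rho/2) >= rho/4. Two entries of different signs contribute
    4 delta^2 to the separation, and 4/32 = 1/8. *)
Lemma sign_prior_minimax (R : realType) (n k : nat) (rho : R)
    (d : measure_display) (Omega : measurableType d)
    (P : 'M[R]_n -> probability Omega R)
    (A : edge n -> {mfun Omega >-> bool}) (I V : finType)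
    (z : {ffun I -> V} -> 'I_n -> 'I_k)
    (sgn : {ffun I -> V} -> 'I_k -> 'I_k -> bool)
    (J : {set I}) (key : 'I_n * 'I_n -> I) (E : I -> {set edge n}) (N m : nat) :
    let node_sgn om i j := sgn om (z om i) (z om j) in
    0 < rho <= 1 -> network_experiment P A ->
    (1 < #|V|)%N -> (0 < N)%N ->
    (forall om a, exists i, z om i = a) ->
    (forall om a b, sgn om a b = sgn om b a) ->
    (forall om i v e, i \in J -> e \notin E i ->
       node_sgn (update om i v) (val e).1 (val e).2 =
       node_sgn om (val e).1 (val e).2) ->
    (forall i, i \in J -> (#|E i| <= N)%N) ->
    (forall om i u v, i \in J -> u != v ->
       (m <= #|[pred q : 'I_n * 'I_n | [&& key q == i, q.1 != q.2 &
         node_sgn (update om i u) q.1 q.2 != node_sgn (update om i v) q.1 q.2]]|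
       )%N) ->
  (((n%:R ^+ 2)^-1 * (#|J|%:R * (m%:R / 8 *
      Num.min (rho ^+ 2 / 16) (rho * ln #|V|%:R / (8 * N%:R)))))%:E
    <= minimax_risk P A (sparse_block_matrices k rho))%E.
Proof.
move=> node_sgn rho01 expt V1 N0 z_surj sgn_sym local cardE sep.
have [rho0 rho1] := andP rho01.
set D := Num.min _ _.
have lnV0 : 0 <= ln (#|V|%:R : R) by rewrite ln_ge0 // ler1n ltnW.
have NR0 : (0 : R) < N%:R by rewrite ltr0n.
have D0 : 0 <= D.
  rewrite /D le_min divr_ge0 ?sqr_ge0 //=.
  by rewrite !mulr_ge0 ?invr_ge0 ?mulr_ge0 // ltW.
have [D1 D2] : D <= rho ^+ 2 / 16 /\ D <= rho * ln #|V|%:R / (8 * N%:R).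
  by rewrite /D !ge_min !lexx orbT.
pose delta := Num.sqrt D.
have delta0 : 0 <= delta by exact: sqrtr_ge0.
have deltaD : delta ^+ 2 = D by rewrite sqr_sqrtr.
have delta_rho : delta <= rho / 4 by nra.
pose lev (b : bool) : R := rho / 2 + (if b then delta else - delta).
have lev_in b : rho / 4 <= lev b <= 3 / 4 * rho.
  by rewrite /lev; case: b; lra.
pose Q om : 'M[R]_k := \matrix_(a, b) lev (sgn om a b).
have Qsym om : (Q om)^T = Q om by apply/matrixP => a b; rewrite !mxE sgn_sym.
pose theta om := block_matrix (z om) (Q om).
have theta_edge om e :
    edge_prob (theta om) e = lev (node_sgn om (val e).1 (val e).2).
  rewrite /edge_prob !mxE; case: eqP => // e12.
  by have := valP e; rewrite e12 ltnn.
apply: (@minimax_risk_ge _ _ _ _ _ _ _ _ theta) => //.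
- rewrite card_ffun expn_gt0; apply/orP; left; exact: ltnW.
- move=> om; apply: block_matrix_sparse => //; first by rewrite ltW.
  by move=> a b; rewrite mxE; have := lev_in (sgn om a b); lra.
- move=> om; apply: block_matrix_model => // a b.
  by rewrite mxE; have := lev_in (sgn om a b); lra.
move=> T.
have -> : m%:R / 8 * D = (4 * D * m%:R) / 32 by field.
apply: (@product_prior_risk _ _ _ _ theta J key E (rho / 2) delta _ N) => //.
- lra.
- move=> om e; rewrite theta_edge.
  by have := lev_in (node_sgn om (val e).1 (val e).2); lra.
- move=> om e; rewrite theta_edge /lev addrC addKr.
  by case: ifP => _; rewrite ?normrN ger0_norm.
- by move=> om i v e iJ eE; rewrite !theta_edge local.
- rewrite deltaD.
  have pp : (rho / 2 * (1 - rho / 2))^-1 <= 4 / rho.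
    rewrite -[4 / rho]invrK invf_div lef_pV2 ?posrE ?divr_gt0 //.
      by nra.
    by rewrite mulr_gt0 // ?divr_gt0 //; lra.
  apply: (@le_trans _ _ (N%:R * (D * (4 / rho)))).
    by rewrite ler_wpM2l ?(ltW NR0) // ler_wpM2l.
  apply: (@le_trans _ _ (N%:R * (rho * ln #|V|%:R / (8 * N%:R) * (4 / rho)))).
    by rewrite ler_wpM2l ?(ltW NR0) // ler_wpM2r // divr_ge0 // ltW.
  by apply/eqP/eqP; rewrite le_eqVlt; apply/orP; left; apply/eqP; field; lra.
- by rewrite !mulr_ge0.
move=> om i u v iJ uv.
pose B := [pred q : 'I_n * 'I_n | [&& key q == i, q.1 != q.2 &
  node_sgn (update om i u) q.1 q.2 != node_sgn (update om i v) q.1 q.2]].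
apply: (@le_trans _ _ (\sum_(q in B) 4 * D)).
  by rewrite sumr_const -[leRHS]mulr_natr ler_wpM2l ?mulr_ge0 // ler_nat sep.
rewrite [leRHS](bigID (mem B)) /=.
rewrite -[leLHS]addr0; apply: lerD; last first.
  by apply: sumr_ge0 => q _; exact: sqr_ge0.
rewrite le_eqVlt; apply/orP; left; apply/eqP.
apply: eq_big => [q|q].
  by rewrite /B inE; case: (key q == i).
rewrite inE => /and3P[_ q12 sq].
rewrite !mxE (negbTE q12) -deltaD.
move: sq; rewrite /node_sgn /lev.
by case: (sgn _ _ _); case: (sgn _ _ _) => //= _; ring.
Qed.

(** * Counting nodes, edges and Walsh disagreements *)

Definition residue (k : nat) (k0 : (0 < k)%N) (i : nat) : 'I_k :=
  Ordinal (ltn_pmod i k0).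

Lemma residue_id (k : nat) (k0 : (0 < k)%N) (a : 'I_k) : residue k0 a = a.
Proof. by apply: val_inj => /=; rewrite modn_small. Qed.

Lemma residue_block (k : nat) (k0 : (0 < k)%N) (a : 'I_k) (t : nat) :
  residue k0 (a + t * k) = a.
Proof. by apply: val_inj => /=; rewrite addnC modnMDl modn_small. Qed.

(** For a in B and t < m / k, the integers a + t k are distinct and less than
    m, and their residues belong to B. *)
Lemma card_residue_ge (n m k : nat) (k0 : (0 < k)%N) (B : {set 'I_k}) :
    (m <= n)%N ->
  (#|B| * (m %/ k) <=
    #|[set i : 'I_n | (i < m)%N && (residue k0 i \in B)]|)%N.
Proof.
move=> mn.
have lt_m (a : 'I_k) (t : 'I_(m %/ k)) : (a + t * k < m)%N.
  apply: (@leq_trans (t.+1 * k)); first by rewrite mulSn ltn_add2r.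
  by apply: leq_trans (leq_trunc_div m k); rewrite leq_mul2r ltn_ord orbT.
pose f (p : 'I_k * 'I_(m %/ k)) : 'I_n :=
  Ordinal (leq_trans (lt_m p.1 p.2) mn).
have f_inj : injective f.
  move=> [a t] [b u] /(congr1 val) /= eqf.
  have ab : a = b.
    by rewrite -(residue_block k0 a t) eqf residue_block.
  congr pair => //; apply: val_inj => /=; apply/eqP.
  by rewrite -(eqn_pmul2r k0); move: eqf; rewrite ab => /addnI ->.
rewrite -[X in (_ * X)%N]card_ord -cardsT -cardsX -(card_imset _ f_inj).
apply: subset_leq_card.
apply/fintype.subsetP => _ /imsetP[[a t] /setXP[aB _] ->].
by rewrite inE /= lt_m /= residue_block.
Qed.

Lemma card_residue_le (n k : nat) (k0 : (0 < k)%N) (a : 'I_k) :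
  (#|[set i : 'I_n | residue k0 i == a]| <= (n %/ k).+1)%N.
Proof.
have lt_q (i : 'I_n) : (i %/ k < (n %/ k).+1)%N.
  by rewrite ltnS leq_div2r // ltnW.
pose f (i : 'I_n) := Ordinal (lt_q i).
rewrite -(@card_in_imset _ _ f).
  by rewrite -[leqRHS]card_ord max_card.
move=> i j; rewrite !inE => /eqP ia /eqP ja /(congr1 val) /= ij.
have /(congr1 val) /= modij : residue k0 i = residue k0 j by rewrite ia ja.
by apply: val_inj; rewrite /= (divn_eq i k) (divn_eq j k) ij modij.
Qed.

(** Each edge meets the rectangle B x C directly or after a transposition. The
    factor 2 covers the case where B and C overlap, as for the edges at a given
    node. *)
Lemma card_edge_rect (n : nat) (B C : {set 'I_n}) :
  (#|[set e : edge n | ((val e).1 \in B) && ((val e).2 \in C) ||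
                       ((val e).1 \in C) && ((val e).2 \in B)]|
    <= 2 * (#|B| * #|C|))%N.
Proof.
rewrite -(card_imset _ val_inj) mul2n -addnn -{1}cardsX mulnC -cardsX.
apply: leq_trans (leq_card_setU _ _).
apply: subset_leq_card; apply/fintype.subsetP => _ /imsetP[e + ->].
by rewrite !inE.
Qed.

(** The parity of the inner product of two binary words: (-1) ^ walsh u v are
    the entries of the Walsh-Hadamard matrix of order 2 ^ r. *)
Definition walsh (r : nat) (u v : {ffun 'I_r -> bool}) : bool :=
  \big[addb/false]_t (u t && v t).

Lemma walshC (r : nat) (u v : {ffun 'I_r -> bool}) : walsh u v = walsh v u.
Proof. by apply: eq_bigr => t _; rewrite andbC. Qed.

(** If u and v differ in position s, then flipping position s of w changes
    exactly one of walsh u w and walsh v w. Hence the flip exchanges the words w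
    on which u and v disagree with those on which they agree. *)
Lemma card_walsh_neq (r : nat) (u v : {ffun 'I_r -> bool}) :
  u != v -> #|[set w | walsh u w != walsh v w]|.*2 = (2 ^ r)%N.
Proof.
move=> uv.
have [s us] : exists s, u s != v s.
  apply/existsP; apply: contraNT uv => /existsPn eq_uv.
  by apply/eqP/ffunP => s; apply/eqP; have := eq_uv s; rewrite negbK.
pose flip (w : {ffun 'I_r -> bool}) := update w s (~~ w s).
have flipK : involutive flip.
  move=> w; apply/ffunP => t; rewrite !ffunE eqxx negbK.
  by case: eqP => // ->.
have walsh_flip a w : walsh a (flip w) = a s (+) walsh a w.
  rewrite /walsh (bigD1 s) //= [in RHS](bigD1 s) //= ffunE eqxx addbA.
  congr (_ (+) _); first by case: (a s); case: (w s).
  by apply: eq_bigr => t /negbTE ts; rewrite ffunE ts.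
set S := [set w | _].
have flipS : flip @: S = ~: S.
  apply/setP => w; rewrite -[w in LHS]flipK (mem_imset _ _ (inv_inj flipK)).
  rewrite !inE !walsh_flip; move: us.
  by case: (u s); case: (v s); case: (walsh u w); case: (walsh v w).
rewrite -addnn -{2}(card_imset (mem S) (inv_inj flipK)) flipS cardsC.
by rewrite card_ffun card_bool card_ord.
Qed.

(** * Known communities, unknown connection probabilities *)

Lemma ln2_bounds (R : realType) : 0 < ln (2 : R) < 2.
Proof. by rewrite ln_gt0 ?ltr1n //= ln_sublinear. Qed.

Lemma leq_twice_floor (m k : nat) :
  (0 < k <= m)%N -> (m <= 2 * (m %/ k) * k)%N.
Proof.
move=> /andP[k0 km]; apply: leq_trans (ltnW (ltn_ceil m k0)) _.
by rewrite leq_mul2r mul2n -addnn -addn1 leq_add2l divn_gt0 // km orbT.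
Qed.

Lemma sqr_le_halves (k : nat) :
  (1 < k)%N -> (k ^ 2 <= 8 * (k./2 * (k - k./2)))%N.
Proof.
move=> k1; have := odd_double_half k; case: (odd k) => /=; lia || nia.
Qed.

(** Here t stands for the floor of n / k, and so lies between n / (2 k) and
    n / k; J is the number of random blocks, t * t the number of entries in
    each of them, and N bounds the number of its edges. *)
Lemma block_rate_le (R : realType) (rho l n k t J N : R) :
    0 < rho -> 0 < l < 2 -> 1 <= t -> 0 < k -> t * k <= n -> n <= 2 * t * k ->
    k ^+ 2 <= 8 * J -> 0 < N -> N <= 8 * t ^+ 2 ->
  l / 128 ^+ 2 * Num.min (rho ^+ 2) (rho * (k ^+ 2 / n ^+ 2)) <=
    (n ^+ 2)^-1 * (J * (t * t / 8 *
      Num.min (rho ^+ 2 / 16) (rho * l / (8 * N)))).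
Proof.
move=> rho0 /andP[l0 l2] t1 k0 tkn n2tk kJ N0 Nt.
have t0 : 0 < t by lra.
have n0 : 0 < n by apply: lt_le_trans tkn; rewrite mulr_gt0.
set mn := Num.min _ _; set mx := Num.min _ _.
have mn0 : 0 <= mn.
  by rewrite /mn le_min sqr_ge0 mulr_ge0 ?divr_ge0 ?sqr_ge0 ?ltW.
have mn_mx : l / 64 * mn <= mx.
  rewrite /mx le_min; apply/andP; split.
    have : mn <= rho ^+ 2 by rewrite /mn ge_min lexx.
    nra.
  have mnk : mn <= rho * (k ^+ 2 / n ^+ 2) by rewrite /mn ge_min lexx orbT.
  rewrite ler_pdivlMr ?mulr_gt0 //.
  have mnk' : mn * n ^+ 2 <= rho * k ^+ 2.
    by move: mnk; rewrite mulrA ler_pdivlMr // exprn_gt0.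
  have tmn : mn * t ^+ 2 <= rho.
    rewrite -(ler_pM2r (exprn_gt0 2 k0)); apply: le_trans mnk'.
    by rewrite -mulrA -exprMn ler_wpM2l // lerXn2r // nnegrE ?mulr_ge0 // ltW.
  apply: (@le_trans _ _ (l / 64 * mn * (8 * (8 * t ^+ 2)))).
    by rewrite ler_wpM2l ?ler_wpM2l // mulr_ge0 // divr_ge0 // ltW.
  have -> : l / 64 * mn * (8 * (8 * t ^+ 2)) = (mn * t ^+ 2) * l by field.
  by rewrite ler_wpM2r // ltW.
rewrite ler_pdivlMl ?exprn_gt0 //.
apply: (@le_trans _ _ (k ^+ 2 / 8 * (t ^+ 2 / 8 * (l / 64 * mn)))).
  have n2 : n ^+ 2 <= (2 * t * k) ^+ 2.
    by rewrite lerXn2r // nnegrE ?mulr_ge0 ?ltW.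
  have -> : k ^+ 2 / 8 * (t ^+ 2 / 8 * (l / 64 * mn)) =
    ((2 * t * k) ^+ 2) * (l / 128 ^+ 2 * mn) by field.
  by rewrite ler_wpM2r // mulr_ge0 // divr_ge0 // ltW.
apply: ler_pM.
- by rewrite divr_ge0 // sqr_ge0.
- by rewrite mulr_ge0 ?divr_ge0 ?sqr_ge0 // mulr_ge0 // divr_ge0 // ltW.
- lra.
by rewrite -expr2 ler_wpM2l // divr_ge0 ?sqr_ge0.
Qed.

(** Node i has label i mod k, so all classes have about n / k nodes. The blocks
    that are guessed have one label below k/2 and the other above: their two
    labels are different and ordered, so that no two of these coordinates
    govern the same entries, and there are still about k^2 / 4 of them. *)
Lemma minimax_risk_blocks (R : realType) (n k : nat) (rho : R)
    (d : measure_display) (Omega : measurableType d)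
    (P : 'M[R]_n -> probability Omega R)
    (A : edge n -> {mfun Omega >-> bool}) :
    (2 <= k <= n)%N -> 0 < rho <= 1 -> network_experiment P A ->
  ((ln 2 / 128 ^+ 2 * Num.min (rho ^+ 2) (rho * (k%:R ^+ 2 / n%:R ^+ 2)))%:E
     <= minimax_risk P A (sparse_block_matrices k rho))%E.
Proof.
move=> /andP[k2 kn] rho01 expt.
have k0 : (0 < k)%N by exact: ltnW.
pose lab (i : 'I_n) : 'I_k := residue k0 i.
pose I : finType := ('I_k * 'I_k)%type.
pose sgn (om : {ffun I -> bool}) (a b : 'I_k) :=
  if (a <= b)%N then om (a, b) else om (b, a).
pose h := k./2.
have hk : (h < k)%N by rewrite /h; lia.
pose lo := [set a : 'I_k | (a < h)%N].
pose J : {set I} := finset.setX lo (~: lo).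
pose cls (a : 'I_k) := [set i | lab i == a].
pose E (p : I) := [set e : edge n |
  ((val e).1 \in cls p.1) && ((val e).2 \in cls p.2) ||
  ((val e).1 \in cls p.2) && ((val e).2 \in cls p.1)].
pose t := (n %/ k)%N.
have card_lo : #|lo| = h.
  have widen_inj : injective (widen_ord (ltnW hk)).
    by move=> a b /(congr1 val) /= ab; exact: val_inj.
  rewrite -[RHS]card_ord -(card_imset _ widen_inj).
  apply: eq_card => a; rewrite inE; apply/idP/imsetP => [ah|[b _ ->]].
    by exists (Ordinal ah) => //; exact: val_inj.
  exact: ltn_ord b.
have cardJ : #|J| = (h * (k - h))%N.
  by rewrite cardsX card_lo cardsCs finset.setCK card_lo card_ord.
have := @sign_prior_minimax R n k rho d Omega P A I bool (fun _ => lab) sgn J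
  (fun q => (lab q.1, lab q.2)) E (2 * (t.+1 * t.+1)) (t * t) rho01 expt.
rewrite card_bool => /(_ isT isT) main.
apply: le_trans (main _ _ _ _ _); last first.
- move=> om [a b] u v /setXP[] /=; rewrite !inE -leqNgt => ah hb uv.
  have card_cls (c : 'I_k) : (t <= #|cls c|)%N.
    have := card_residue_ge k0 [set c] (leqnn n).
    rewrite cards1 mul1n => /leq_trans; apply; apply: subset_leq_card.
    by apply/fintype.subsetP => i; rewrite !inE ltn_ord.
  apply: leq_trans (leq_mul (card_cls a) (card_cls b)) _.
  rewrite -cardsX; apply: subset_leq_card; apply/fintype.subsetP => -[i j].
  rewrite !inE /= => /andP[/eqP ia /eqP jb].
  rewrite ia jb eqxx /=; apply/andP; split.
    apply: contraTneq isT => ij; move: ah hb.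
    by rewrite -ia -jb ij ltnNge => /negbTE ->.
  by rewrite /sgn (leq_trans (ltnW ah) hb) !ffunE eqxx.
- move=> p _; apply: leq_trans (card_edge_rect _ _) _.
  by rewrite leq_mul2l leq_mul ?card_residue_le.
- move=> om [a b] v e /setXP[] /=; rewrite !inE -leqNgt => ah hb eE.
  have ab : (a <= b)%N by exact: leq_trans (ltnW ah) hb.
  rewrite /sgn; case: ifP => _; rewrite !ffunE; case: eqP => // -[ea eb];
    by move: eE; rewrite ea eb !eqxx ?orbT.
- move=> om a b; rewrite /sgn; case: ltngtP => // ab.
  by rewrite (val_inj ab).
- move=> _ a; exists (widen_ord kn a); exact: residue_id.
rewrite lee_fin cardJ [(t * t)%:R]natrM; clear main.
apply: block_rate_le.
- by case/andP: rho01.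
- exact: ln2_bounds.
- by rewrite ler1n divn_gt0.
- by rewrite ltr0n.
- by rewrite -natrM ler_nat leq_trunc_div.
- by rewrite -!natrM ler_nat leq_twice_floor ?k0.
- by rewrite -natrX -natrM ler_nat sqr_le_halves.
- by rewrite ltr0n.
- rewrite -natrX -natrM ler_nat.
  rewrite [leqRHS](_ : _ = (2 * (2 * t * (2 * t)))%N); last by lia.
  have : (0 < t)%N by rewrite divn_gt0.
  by move=> t0; rewrite leq_mul2l leq_mul // mul2n -addnn -addn1 leq_add2l.
Qed.

(** * Known connection probabilities, unknown communities *)

Lemma ln_le_double_ln (R : realType) (k r : nat) :
  (0 < k)%N -> (0 < r)%N -> (k < 2 ^ r.+1)%N ->
  ln (k%:R : R) <= 2 * ln (2 ^ r)%:R.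
Proof.
move=> k0 r0 kr.
have -> : 2 * ln (2 ^ r)%:R = ln ((2 ^ r * 2 ^ r)%:R : R).
  by rewrite natrM lnM ?posrE ?ltr0n ?expn_gt0 //; ring.
rewrite ler_ln ?posrE ?ltr0n ?muln_gt0 ?expn_gt0 //.
rewrite ler_nat (leq_trans (ltnW kr)) // expnS leq_mul //.
by rewrite -{1}(expn1 2) leq_exp2l.
Qed.

(** Here lk and lM stand for ln k and ln #|V|, J is the number of nodes with
    unknown label, and m the number of entries that separate two labels of a
    node. *)
Lemma label_rate_le (R : realType) (rho lk lM n J m : R) :
    0 < rho -> 0 <= lk -> lk <= 2 * lM -> 0 < n -> n <= 4 * J -> n <= 16 * m ->
  Num.min (rho ^+ 2) (rho * (lk / n)) / 128 ^+ 2 <=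
    (n ^+ 2)^-1 * (J * (m / 8 *
      Num.min (rho ^+ 2 / 16) (rho * lM / (8 * (2 * n))))).
Proof.
move=> rho0 lk0 lkM n0 nJ nm.
set mn := Num.min _ _; set mx := Num.min _ _.
have mn0 : 0 <= mn by rewrite /mn le_min sqr_ge0 mulr_ge0 ?divr_ge0 // ltW.
have mn_mx : mn / 32 <= mx.
  rewrite /mx le_min; apply/andP; split.
    have : mn <= rho ^+ 2 by rewrite /mn ge_min lexx.
    nra.
  have mnk : mn <= rho * (lk / n) by rewrite /mn ge_min lexx orbT.
  apply: (@le_trans _ _ (rho * (lk / n) / 32)); first by rewrite ler_pM2r.
  have -> : rho * lM / (8 * (2 * n)) = (rho / n) * (lM / 16) by field; lra.
  have -> : rho * (lk / n) / 32 = (rho / n) * (lk / 32) by field; lra.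
  by apply: ler_wpM2l; [rewrite divr_ge0 // ltW | lra].
rewrite ler_pdivlMl ?exprn_gt0 //.
have -> : n ^+ 2 * (mn / 128 ^+ 2) = n / 4 * (n / 16 / 8 * (mn / 32)) by field.
apply: ler_pM.
- by rewrite divr_ge0 // ltW.
- by rewrite mulr_ge0 ?divr_ge0 ?(ltW n0).
- lra.
apply: ler_pM => //.
- by rewrite !divr_ge0 // ltW.
- by rewrite divr_ge0.
- lra.
Qed.

(** The first half of the nodes has labels i mod k, which meet every label and
    make all label maps surjective. A node of the second half has one of the
    2 ^ r labels that encode the binary words of length r. Two such labels give
    different signs on half of the words, and each word is carried by at least
    m / k known nodes, with m the number of known nodes. *)
Lemma minimax_risk_labels (R : realType) (n k : nat) (rho : R)
    (d : measure_display) (Omega : measurableType d)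
    (P : 'M[R]_n -> probability Omega R)
    (A : edge n -> {mfun Omega >-> bool}) :
    (2 <= k)%N -> (2 * k <= n)%N -> 0 < rho <= 1 -> network_experiment P A ->
  ((Num.min (rho ^+ 2) (rho * (ln k%:R / n%:R)) / 128 ^+ 2)%:E
     <= minimax_risk P A (sparse_block_matrices k rho))%E.
Proof.
move=> k2 kn rho01 expt.
have k0 : (0 < k)%N by exact: ltnW.
pose r := trunc_log 2 k.
have [rk kr] : (2 ^ r <= k)%N /\ (k < 2 ^ r.+1)%N.
  by apply/andP; exact: trunc_log_bounds.
have r0 : (0 < r)%N.
  by rewrite lt0n; apply: contraTneq kr => ->; rewrite expn1 -leqNgt.
pose V : finType := {ffun 'I_r -> bool}.
have cardV : #|V| = (2 ^ r)%N by rewrite card_ffun card_bool card_ord.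
have Vk (v : V) : (index v (enum V) < k)%N.
  by apply: leq_trans rk; rewrite -cardV cardE index_mem mem_enum.
pose label (v : V) : 'I_k := Ordinal (Vk v).
(* The labels from 2 ^ r on encode no word of their own, and receive the
   default word. *)
pose word (a : 'I_k) : V := nth [ffun=> false] (enum V) a.
have labelK : cancel label word by move=> v; rewrite /word nth_index ?mem_enum.
pose m := uphalf n.
have mn : (m <= n)%N by rewrite /m; lia.
have km : (k <= m)%N by rewrite /m; lia.
pose z (om : {ffun 'I_n -> V}) (i : 'I_n) : 'I_k :=
  if (i < m)%N then residue k0 i else label (om i).
pose sgn (om : {ffun 'I_n -> V}) (a b : 'I_k) := walsh (word a) (word b).
pose J := [set i : 'I_n | (m <= i)%N].
pose E (i : 'I_n) := [set e : edge n |
  ((val e).1 \in [set i]) && ((val e).2 \in [set: 'I_n]) ||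
  ((val e).1 \in [set: 'I_n]) && ((val e).2 \in [set i])].
have cardJ : (n./2 <= #|J|)%N.
  have lt_n (t : 'I_(n./2)) : (m + t < n)%N.
    by have := ltn_ord t; rewrite /m; lia.
  pose f t := Ordinal (lt_n t).
  have f_inj : injective f.
    by move=> t u /(congr1 val) /= /addnI tu; exact: val_inj.
  rewrite -[leqLHS]card_ord -(card_imset _ f_inj).
  apply: subset_leq_card; apply/fintype.subsetP => _ /imsetP[t _ ->].
  by rewrite inE leq_addr.
have := @sign_prior_minimax R n k rho d Omega P A 'I_n V z sgn J
  (fun q => q.1) E (2 * n) (2 ^ r.-1 * (m %/ k)) rho01 expt.
rewrite cardV -{1}(expn0 2) ltn_exp2l // => /(_ r0) main.
apply: le_trans (main _ _ _ _ _ _); last first.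
- move=> om i u v; rewrite inE => mi uv.
  pose B := [set a : 'I_k | walsh u (word a) != walsh v (word a)].
  have cardB : (2 ^ r.-1 <= #|B|)%N.
    have card_uv := card_walsh_neq uv.
    have -> : (2 ^ r.-1)%N = #|[set w | walsh u w != walsh v w]|.
      by apply: double_inj; rewrite card_uv -mul2n -expnS prednK.
    rewrite -(card_imset _ (can_inj labelK)); apply: subset_leq_card.
    by apply/fintype.subsetP => _ /imsetP[w + ->]; rewrite !inE labelK.
  apply: leq_trans (leq_mul cardB (leqnn _)) _.
  apply: leq_trans (card_residue_ge k0 B mn) _.
  have pair_inj : injective (fun j : 'I_n => (i, j)) by move=> j j' [].
  rewrite -(card_imset _ pair_inj); apply: subset_leq_card.
  apply/fintype.subsetP => _ /imsetP[j + ->].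
  rewrite !inE /= eqxx => /andP[jm jB].
  apply/and3P; split=> //; first by apply: contraTneq jm => <-; rewrite -leqNgt.
  by rewrite /sgn /z jm ltnNge mi /= !ffunE eqxx !labelK.
- move=> i _; apply: leq_trans (card_edge_rect _ _) _.
  by rewrite cards1 mul1n cardsT card_ord.
- move=> om i v e _; rewrite !inE andbT andTb => /norP[/negbTE e1 /negbTE e2].
  by rewrite /sgn /z !ffunE e1 e2.
- by move=> om a b; rewrite /sgn walshC.
- move=> om a; have am : (a < m)%N := leq_trans (ltn_ord a) km.
  by exists (Ordinal (leq_trans am mn)); rewrite /z /= am residue_id.
- by rewrite muln_gt0 (leq_trans _ mn) // (leq_trans _ km).
rewrite lee_fin [(2 * n)%:R]natrM; clear main.
apply: label_rate_le.
- by case/andP: rho01.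
- by rewrite ln_ge0 // ler1n.
- exact: ln_le_double_ln.
- by rewrite ltr0n; lia.
- rewrite -natrM ler_nat; move: cardJ; move: #|J| => w; lia.
rewrite -natrM ler_nat.
have kr' : (k <= 4 * 2 ^ r.-1)%N.
  by rewrite -[4%N]/(2 * 2)%N -mulnA -!expnS prednK // ltnW.
have n2m : (n <= 2 * m)%N by rewrite /m; lia.
have := @leq_twice_floor m k; rewrite k0 km => /(_ isT) mk.
apply: (leq_trans n2m); apply: leq_trans (leq_mul (leqnn 2) mk) _.
apply: leq_trans (leq_mul (leqnn 2) (leq_mul (leqnn _) kr')) _.
move: (m %/ k)%N (2 ^ r.-1)%N => q w; lia.
Qed.

(** * The minimax lower bound *)

Theorem proposition2p4 (R : realType) :
  exists C : R, 0 < C /\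
    forall (n k : nat) (rho : R), (2 <= k <= n)%N -> 0 < rho <= 1 ->
    forall (d : measure_display) (Omega : measurableType d)
      (P : 'M[R]_n -> probability Omega R)
      (A : edge n -> {mfun Omega >-> bool}),
      network_experiment P A ->
      ((C * Num.min
              (rho * (ln k%:R / n%:R + k%:R ^+ 2 / n%:R ^+ 2))
              (rho ^+ 2))%:E
         <= minimax_risk P A (sparse_block_matrices k rho))%E.
Proof.
have [l0 l2] := andP (ln2_bounds R).
exists (ln 2 / 256 ^+ 2); split; first by rewrite divr_gt0 ?exprn_gt0 ?ltr0n.
move=> n k rho k2n rho01 d Omega P A expt.
have [k2 kn] := andP k2n; have [rho0 rho1] := andP rho01.
have k0 : (0 : R) < k%:R by rewrite ltr0n ltnW.
have n0 : (0 : R) < n%:R by rewrite ltr0n (leq_trans _ kn) // ltnW.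
set a := ln k%:R / n%:R; set b := k%:R ^+ 2 / n%:R ^+ 2.
have a0 : 0 <= a by rewrite divr_ge0 ?ln_ge0 ?ler1n ?ltW // ltnW.
have b0 : 0 <= b by rewrite divr_ge0 ?sqr_ge0.
have min_scale (c x y : R) : 1 <= c -> y <= c * x ->
    Num.min y (rho ^+ 2) <= c * Num.min (rho ^+ 2) x.
  move=> c1 ycx; rewrite ge_min.
  have [_|_] := leP (rho ^+ 2) x; apply/orP; [right|left; exact: ycx].
  by rewrite ler_peMl // sqr_ge0.
have min0 x : 0 <= x -> 0 <= Num.min (rho ^+ 2) x.
  by move=> x0; rewrite le_min sqr_ge0.
(* The prior on the labels is used where it is available and its term
   dominates. *)
have [large_a|small_a] := boolP ((2 * k <= n)%N && (b <= a)).
  have [kn2 ba] := andP large_a.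
  apply: le_trans (minimax_risk_labels k2 kn2 rho01 expt).
  rewrite lee_fin.
  have ra : 0 <= rho * a by rewrite mulr_ge0 // ltW.
  have := min_scale 2 (rho * a) (rho * (a + b)).
  have := min0 _ ra; set mn := Num.min (rho ^+ 2) _; set mx := Num.min _ _.
  move=> mn0 mx_mn.
  have {}mx_mn : mx <= 2 * mn by apply: mx_mn; nra.
  nra.
apply: le_trans (minimax_risk_blocks k2n rho01 expt).
rewrite lee_fin.
have ab : a <= 2 * b.
  move: small_a; rewrite negb_and -ltnNge -ltNge => /orP[nk|ab]; last lra.
  rewrite /a /b.
  have -> : 2 * (k%:R ^+ 2 / n%:R ^+ 2) = k%:R * (2 * k%:R / n%:R) / n%:R :> R
    by field; lra.
  rewrite ler_pM2r ?invr_gt0 //.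
  have : ln (k%:R : R) < k%:R by exact: ln_sublinear.
  have : 1 <= 2 * k%:R / n%:R :> R.
    by rewrite ler_pdivlMr // mul1r -natrM ler_nat ltnW.
  nra.
have rb : 0 <= rho * b by rewrite mulr_ge0 // ltW.
have := min_scale 3 (rho * b) (rho * (a + b)).
have := min0 _ rb; set mn := Num.min (rho ^+ 2) _; set mx := Num.min _ _.
move=> mn0 mx_mn.
have {}mx_mn : mx <= 3 * mn by apply: mx_mn; nra.
nra.
Qed.
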